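(* For every integer $n\ge0$ and every $x$, the Laguerre polynomials are obtained from the Jacobi polynomials by a Möbius transformation followed by a limit: for $\beta>-1$, $$L_n^\beta(x)=\lim_{\alpha\to\infty}\left(\frac{x+\alpha+1}{\alpha+1}\right)^n(-1)^nJ_n^{(\alpha,\beta)}\left(\frac{x-\alpha-1}{x+\alpha+1}\right)=\lim_{\alpha\to\infty}(-1)^nJ_n^{(\alpha,\beta)}\left(\frac{x-\alpha-1}{x+\alpha+1}\right),$$ and, for $\alpha>-1$, $$L_n^\alpha(x)=\lim_{\beta\to\infty}\left(\frac{x+\beta+1}{\beta+1}\right)^nJ_n^{(\alpha,\beta)}\left(\frac{\beta+1-x}{\beta+1+x}\right)=\lim_{\beta\to\infty}J_n^{(\alpha,\beta)}\left(\frac{\beta+1-x}{\beta+1+x}\right).$$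
   Context: $J_n^{(\alpha,\beta)}(x)=\sum_{k=0}^n\binom{n+\alpha}{n-k}\binom{n+\beta}{k}\left(\frac{x-1}{2}\right)^k\left(\frac{x+1}{2}\right)^{n-k}$ are the Jacobi polynomials and $L_n^\alpha(x)=\sum_{k=0}^n\binom{n+\alpha}{n-k}\frac{(-x)^k}{k!}$ the associated Laguerre polynomials (standard normalizations). The limits are taken through real values of the parameter tending to $+\infty$. *)

(* Defs.v *)
From HB Require Import structures.
From mathcomp Require Import all_boot all_order all_algebra.
From mathcomp Require Import complex.
From mathcomp Require Import all_classical all_reals all_analysis.

Set Implicit Arguments.
Unset Strict Implicit.
Unset Printing Implicit Defensive.

Import Order.TTheory GRing.Theory Num.Theory.
Local Open Scope ring_scope.

(* Binomial coefficient with an arbitrary upper entry: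
   a (a - 1) ... (a - k + 1) / k!. *)
Definition gbinom (K : numFieldType) (a : K) (k : nat) : K :=
  (\prod_(i < k) (a - i%:R)) / k`!%:R.

Definition jacobi (K : numFieldType) (n : nat) (a b : K) : {poly K} :=
  \sum_(k < n.+1)
    (gbinom (n%:R + a) (n - k) * gbinom (n%:R + b) k)
      *: ((2^-1 *: ('X - 1)) ^+ k * (2^-1 *: ('X + 1)) ^+ (n - k)).

Definition laguerre (K : numFieldType) (n : nat) (a : K) : {poly K} :=
  \sum_(k < n.+1) (gbinom (n%:R + a) (n - k) / k`!%:R) *: (- 'X) ^+ k.

(* Main.v *)
(** At the Möbius point y = (b+1-x)/(b+1+x) one has (y-1)/2 = -x u and
    (y+1)/2 = 1 - x u with u = 1/(b+1+x), and each factor n+b-i of the second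
    binomial coefficient, multiplied by u, equals 1 + (n-i-1-x) u.  So
    J_n^(a,b)(y) is a polynomial in u whose constant term is L_n^a(x), and
    u -> 0 as b -> +oo.  The limit in the first parameter follows from
    (-1)^n J_n^(a,b)(-y) = J_n^(b,a)(y). *)
Require Import Defs.
From HB Require Import structures.
From mathcomp Require Import all_boot all_order all_algebra.
From mathcomp Require Import complex ring.
From mathcomp Require Import all_classical all_reals all_analysis.

Set Implicit Arguments.
Unset Strict Implicit.
Unset Printing Implicit Defensive.

Import Order.TTheory GRing.Theory Num.Theory.
Import numFieldNormedType.Exports.
Local Open Scope classical_set_scope.
Local Open Scope ring_scope.
Local Open Scope complex_scope.

(** Reversing the summation index swaps the two binomial coefficients, and negating [y] swaps
    [(y - 1) / 2] and [(y + 1) / 2] up to a sign in each factor. *)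
Lemma jacobiN (K : numFieldType) (n : nat) (a b y : K) :
  (-1) ^+ n * (jacobi n a b).[- y] = (jacobi n b a).[y].
Proof.
rewrite /jacobi !horner_sum mulr_sumr (reindex_inj rev_ord_inj) /=.
apply: eq_bigr => -[k kn] _ /=; rewrite ltnS in kn.
rewrite subSS subKn //; move: (gbinom _ k) (gbinom _ (n - k)) => g h.
(* Split [(-1) ^+ n] into [(-1) ^+ (n - k) * (-1) ^+ k], so that each part cancels the sign coming
   out of one of the two powers. *)
rewrite !hornerE /= -{1}(subnK kn) exprD.
have -> : - y - 1 = - (y + 1) by ring.
have -> : - y + 1 = - (y - 1) by ring.
rewrite !mulrN; move: (2^-1 * (y - 1)) (2^-1 * (y + 1)) => u v.
rewrite (exprNn u) (exprNn v).
set s := (-1) ^+ (n - k); set t := (-1) ^+ k.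
have hs : s * s = 1 by rewrite -exprMn mulrNN mulr1 expr1n.
have ht : t * t = 1 by rewrite -exprMn mulrNN mulr1 expr1n.
transitivity ((s * s) * (t * t) *
    ((h * g) * (u ^+ k * v ^+ (n - k)))).
  by move: (u ^+ k) (v ^+ _) => *; ring.
by rewrite hs ht !mul1r !mulrA.
Qed.

Lemma jacobi_mobiusN (K : numFieldType) (n : nat) (a b x : K) :
  (-1) ^+ n * (jacobi n a b).[(x - a - 1) / (x + a + 1)] =
  (jacobi n b a).[(a + 1 - x) / (a + 1 + x)].
Proof.
rewrite -(jacobiN n a b) -mulNr.
have -> : - (a + 1 - x) = x - a - 1 by ring.
by have -> : a + 1 + x = x + a + 1 by ring.
Qed.

(* The polynomial in the variable u = 1/(b+1+x); it does not depend on b. *)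
Definition jacobi_mobius (K : numFieldType) (n : nat) (a x : K) : {poly K} :=
  \sum_(k < n.+1) (gbinom (n%:R + a) (n - k) / k`!%:R) *:
    ((\prod_(i < k) (1 + (n%:R - i%:R - 1 - x) *: 'X)) * ((- x) ^+ k)%:P *
     (1 - x *: 'X) ^+ (n - k)).

Lemma horner_jacobi_mobius (K : numFieldType) (n : nat) (a b x : K) :
  b + 1 + x != 0 ->
  (jacobi n a b).[(b + 1 - x) / (b + 1 + x)] =
  (jacobi_mobius n a x).[(b + 1 + x)^-1].
Proof.
move=> s0; rewrite /jacobi /jacobi_mobius !horner_sum.
apply: eq_bigr => -[k kn] _ /=; rewrite !hornerE horner_prod /gbinom /=.
(* The extracted [(b + 1 + x) ^+ k] will cancel the denominator of [(- x / (b + 1 + x)) ^+ k], so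
   [b] survives only through the inverse. *)
have -> : \prod_(i < k) (n%:R + b - i%:R) =
    (b + 1 + x) ^+ k *
    \prod_(i < k) (1 + (n%:R - i%:R - 1 - x) *: 'X).[(b + 1 + x)^-1].
  rewrite -[X in _ ^+ X](card_ord k) -prodr_const -big_split /=.
  by apply: eq_bigr => i _; rewrite !hornerE; field.
have -> : 2^-1 * ((b + 1 - x) / (b + 1 + x) - 1) = - x / (b + 1 + x).
  by field.
have -> : 2^-1 * ((b + 1 - x) / (b + 1 + x) + 1) = 1 - x / (b + 1 + x).
  by field.
rewrite expr_div_n; field.
by rewrite !pnatr_eq0 -!lt0n !fact_gt0 expf_neq0.
Qed.

Lemma horner0_jacobi_mobius (K : numFieldType) (n : nat) (a x : K) :
  (jacobi_mobius n a x).[0] = (laguerre n a).[x].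
Proof.
rewrite /jacobi_mobius /laguerre !horner_sum; apply: eq_bigr => k _.
rewrite !hornerE horner_prod /= big1 => [|i _].
  by rewrite subr0 expr1n !mulr1.
by rewrite !hornerE.
Qed.

(** Induction along the Horner scheme. The source of [f] is arbitrary, so a real parameter may drive
    values in [R[i]]. *)
Lemma cvg_horner (K : numFieldType) (T : Type) (F : set_system T)
    {FF : Filter F} (p : {poly K}) (f : T -> K) (l : K) :
  f @ F --> l -> p.[f t] @[t --> F] --> p.[l].
Proof.
move=> fl; elim/poly_ind: p => [|p c IH].
  under eq_fun do rewrite horner0.
  by rewrite horner0; exact: cvg_cst.
under eq_fun do rewrite !hornerE.
by rewrite !hornerE; apply: cvgD; [exact: cvgM|exact: cvg_cst].
Qed.

(** Reverse triangle inequality. The bound [M] lives in [R[i]], as norms there do; being real, it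
    can be compared with [t]. *)
Lemma near_pinfty_normc_gt (R : realType) (z M : R[i]) : M \is Num.real ->
  \forall t \near +oo, M < `|t%:C + z|.
Proof.
move=> Mr; have rr : M + `|z| \is Num.real by rewrite realD ?normr_real.
near=> t.
have t0 : 0 < t by near: t; exact: nbhs_pinfty_gt.
(* [M + |z|] is real, so its real part is that same threshold, read in [R]. *)
have Mt : complex.Re (M + `|z|) < t.
  by near: t; exact: nbhs_pinfty_gt (num_real _).
apply: lt_le_trans (lerB_normD _ _).
by rewrite ltrBrDr -(RRe_real rr) [X in _ < X]ger0_norm ?lecR ?ltcR // ltW.
Unshelve. all: by end_near. Qed.

(** Denominators such as [b + 1 + x] may vanish for some [b]; the algebraic identities are therefore
    used only near [+oo]. *)
Lemma near_pinfty_addC_neq0 (R : realType) (z : R[i]) :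
  \forall t \near +oo, t%:C + z != 0.
Proof.
move: (near_pinfty_normc_gt z (@real0 R[i])).
by apply: filterS => t; rewrite normr_gt0.
Qed.

Lemma cvg_invC_pinfty (R : realType) (z : R[i]) :
  (fun t : R => (t%:C + z)^-1 : R[i]^o) @ +oo --> (0 : R[i]^o).
Proof.
apply/cvgr0Pnorm_lt => e e0.
(* A positive element of [R[i]] is real, which makes [e^-1] an admissible bound for the norm. *)
have er : e^-1 \is Num.real by rewrite gtr0_real ?invr_gt0.
move: (near_pinfty_normc_gt z er); apply: filterS => t Ht.
by rewrite normfV invf_plt // posrE (lt_trans _ Ht) // invr_gt0.
Qed.

Lemma cvg_jacobi_laguerre (R : realType) (n : nat) (a : R) (x : R[i]) :
  (fun b : R =>
     (jacobi n a%:C b%:C).[(b%:C + 1 - x) / (b%:C + 1 + x)] : R[i]^o) @ +oo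
  --> ((laguerre n a%:C).[x] : R[i]^o).
Proof.
rewrite -horner0_jacobi_mobius.
have H := cvg_horner (p := jacobi_mobius n a%:C x)
  (cvg_invC_pinfty (1 + x)).
apply: (cvg_trans _ (H _)); apply: near_eq_cvg.
move: (near_pinfty_addC_neq0 (1 + x)); apply: filterS => b.
by rewrite addrA => s0; rewrite horner_jacobi_mobius.
Qed.

Lemma cvg_mobius_prefactor (R : realType) (n : nat) (x : R[i]) :
  (fun b : R => ((x + b%:C + 1) / (b%:C + 1)) ^+ n : R[i]^o) @ +oo
  --> (1 : R[i]^o).
Proof.
(* With [u = 1 / (b + 1)] the prefactor is [(1 + x u) ^+ n], again a fixed polynomial in a variable
   tending to 0. *)
pose p : {poly R[i]} := (1 + x *: 'X) ^+ n.
have p0 : p.[0] = 1 by rewrite !hornerE expr1n.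
have := cvg_horner (p := p) (cvg_invC_pinfty 1); rewrite p0 => H.
apply: (cvg_trans _ (H _)); apply: near_eq_cvg.
move: (near_pinfty_addC_neq0 (1 : R[i])); apply: filterS => b b0.
by rewrite !hornerE /=; congr (_ ^+ n); field.
Qed.

Theorem mainTheorem13 (R : realType) (n : nat) (x : R[i]) :
  (forall b : R, -1 < b ->
     ((fun a : R => ((x + a%:C + 1) / (a%:C + 1)) ^+ n * (-1) ^+ n *
         (jacobi n a%:C b%:C).[(x - a%:C - 1) / (x + a%:C + 1)] : R[i]^o) @ +oo
       --> ((laguerre n b%:C).[x] : R[i]^o)) /\
     ((fun a : R => (-1) ^+ n *
         (jacobi n a%:C b%:C).[(x - a%:C - 1) / (x + a%:C + 1)] : R[i]^o) @ +oo
       --> ((laguerre n b%:C).[x] : R[i]^o))) /\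
  (forall a : R, -1 < a ->
     ((fun b : R => ((x + b%:C + 1) / (b%:C + 1)) ^+ n *
         (jacobi n a%:C b%:C).[(b%:C + 1 - x) / (b%:C + 1 + x)] : R[i]^o) @ +oo
       --> ((laguerre n a%:C).[x] : R[i]^o)) /\
     ((fun b : R =>
         (jacobi n a%:C b%:C).[(b%:C + 1 - x) / (b%:C + 1 + x)] : R[i]^o) @ +oo
       --> ((laguerre n a%:C).[x] : R[i]^o))).
Proof.
have prefactor (a : R) :
    (fun b : R => ((x + b%:C + 1) / (b%:C + 1)) ^+ n *
       (jacobi n a%:C b%:C).[(b%:C + 1 - x) / (b%:C + 1 + x)] : R[i]^o) @ +oo
    --> ((laguerre n a%:C).[x] : R[i]^o).
  rewrite -[X in _ --> X]mul1r.
  by apply: cvgM; [exact: cvg_mobius_prefactor|exact: cvg_jacobi_laguerre].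
(* The sign symmetry turns both limits in the first parameter into limits in the second, with the
   fixed parameter moved to the first place. *)
split=> [b _|a _]; split; [|under eq_fun do rewrite jacobi_mobiusN..| |].
- by under eq_fun do rewrite -mulrA jacobi_mobiusN; exact: prefactor.
- exact: cvg_jacobi_laguerre.
- exact: prefactor.
- exact: cvg_jacobi_laguerre.
Qed.
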